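(* Let $\mathcal{A}_1$ and $\mathcal{A}_2$ be the $1$-dimensional associative algebras over $\mathbb{C}$ with basis $\{e_1\}$ and products $e_1\cdot e_1=0$ and $e_1\cdot e_1=e_1$ respectively. The compatible dendriform algebra structures on these algebras, and the solutions $r\in\mathcal{A}\otimes\mathcal{A}$ of the corresponding $D$-equations, are the following: (1) on $\mathcal{A}_1$, the only compatible dendriform algebra structure is $e_1\prec e_1=e_1\succ e_1=0$, and the solutions of its $D$-equation are exactly $r=a_{11}\,e_1\otimes e_1$ with $a_{11}\in\mathbb{C}$ arbitrary; (2) on $\mathcal{A}_2$, the compatible dendriform algebra structures are exactly $e_1\succ e_1=\lambda e_1$, $e_1\prec e_1=(1-\lambda)e_1$ with $\lambda\in\{0,1\}$, and for each of them the solutions of its $D$-equation are exactly $r=a_{11}\,e_1\otimes e_1$ with $a_{11}\in\mathbb{C}$ arbitrary.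
   Context: All vector spaces, algebras and parameters are over $\mathbb{C}$. A dendriform algebra $(\mathcal{A},\prec,\succ)$ is a vector space $\mathcal{A}$ with two bilinear products $\prec,\succ$ such that for all $x,y,z\in\mathcal{A}$: $(x\prec y)\prec z=x\prec(y\ast z)$, $(x\succ y)\prec z=x\succ(y\prec z)$, $x\succ(y\succ z)=(x\ast y)\succ z$, where $x\ast y=x\prec y+x\succ y$. The product $\ast$ is then associative. A compatible dendriform algebra structure on an associative algebra $(\mathcal{A},\cdot)$ is a dendriform algebra structure $(\prec,\succ)$ on the vector space $\mathcal{A}$ with $x\prec y+x\succ y=x\cdot y$ for all $x,y\in\mathcal{A}$. For a dendriform algebra $(\mathcal{A},\prec,\succ)$ and $r=\sum_i x_i\otimes y_i\in\mathcal{A}\otimes\mathcal{A}$, the $D$-equation is $r_{12}\ast r_{13}=r_{13}\prec r_{23}+r_{23}\succ r_{12}$ in $\mathcal{A}\otimes\mathcal{A}\otimes\mathcal{A}$, where $r_{12}\ast r_{13}=\sum_{i,j}x_i\ast x_j\otimes y_i\otimes y_j$, $r_{13}\prec r_{23}=\sum_{i,j}x_i\otimes x_j\otimes y_i\prec y_j$, and $r_{23}\succ r_{12}=\sum_{i,j}x_j\otimes x_i\succ y_j\otimes y_i$. *)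

(* Defs.v *)
From HB Require Import structures.
From mathcomp Require Import all_boot all_order all_algebra generic_quotient.
From mathcomp Require Import boolp reals complex.

Set Implicit Arguments.
Unset Strict Implicit.
Unset Printing Implicit Defensive.

Import GRing.Theory.

Local Open Scope ring_scope.
Local Open Scope quotient_scope.

Notation is_bilinear f := (bilinear_for *:%R *:%R f).

(* The tensor product U (x) V: a sequence [:: (x_1, y_1); ..; (x_n, y_n)]
   stands for the formal sum of the x_i (x) y_i, and two formal sums are
   identified by the congruence generated by commutativity of the sum and
   bilinearity of (x). *)
Section Tensor.
Variables (K : fieldType) (U V : lmodType K).

Inductive tens_rel : seq (U * V) -> seq (U * V) -> Prop :=
| TensRefl s : tens_rel s s
| TensSym s t : tens_rel s t -> tens_rel t s
| TensTrans s t u : tens_rel s t -> tens_rel t u -> tens_rel s u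
| TensCat s s' t t' :
    tens_rel s s' -> tens_rel t t' -> tens_rel (s ++ t) (s' ++ t')
| TensCatC s t : tens_rel (s ++ t) (t ++ s)
| TensDl x x' y : tens_rel [:: (x + x', y)] [:: (x, y); (x', y)]
| TensDr x y y' : tens_rel [:: (x, y + y')] [:: (x, y); (x, y')]
| TensZ a x y : tens_rel [:: (a *: x, y)] [:: (x, a *: y)]
| Tens0 y : tens_rel [:: (0, y)] [::].

Definition tens_equiv_rel : rel (seq (U * V)) := fun s t => `[< tens_rel s t >].

Lemma tens_equiv_refl : reflexive tens_equiv_rel.
Proof. by move=> s; apply/asboolP; exact: TensRefl. Qed.

Lemma tens_equiv_sym : symmetric tens_equiv_rel.
Proof. by move=> s t; apply/asboolP/asboolP; exact: TensSym. Qed.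

Lemma tens_equiv_trans : transitive tens_equiv_rel.
Proof.
move=> t s u /asboolP st /asboolP tu; apply/asboolP.
exact: TensTrans st tu.
Qed.

Canonical tens_equiv :=
  EquivRel tens_equiv_rel tens_equiv_refl tens_equiv_sym tens_equiv_trans.

Definition tensor := {eq_quot tens_equiv}.
HB.instance Definition _ := Choice.on tensor.
HB.instance Definition _ := EqQuotient.on tensor.

Implicit Types (s t : seq (U * V)) (p q r : tensor).

Lemma tens_piP s t : \pi_tensor s = \pi_tensor t <-> tens_rel s t.
Proof.
split; first by move/eqP; rewrite piE => /asboolP.
by move=> st; apply/eqP; rewrite piE; apply/asboolP.
Qed.

Lemma tens_reprP s : tens_rel (repr (\pi_tensor s)) s.
Proof. by apply/tens_piP; rewrite reprK. Qed.

Definition tens_add p q : tensor := \pi_tensor (repr p ++ repr q).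
Definition tens_scale (a : K) p : tensor :=
  \pi_tensor [seq (a *: xy.1, xy.2) | xy <- repr p].
Definition tens_opp p : tensor := tens_scale (-1) p.
Definition tens_zero : tensor := \pi_tensor [::].

Lemma tens_rel_scale a s t : tens_rel s t ->
  tens_rel [seq (a *: xy.1, xy.2) | xy <- s] [seq (a *: xy.1, xy.2) | xy <- t].
Proof.
elim=> /=.
- by move=> *; exact: TensRefl.
- by move=> ? ? _; exact: TensSym.
- by move=> ? ? ? _ h _; exact: TensTrans.
- by move=> ? ? ? ? _ h _ h'; rewrite !map_cat; exact: TensCat.
- by move=> ? ?; rewrite !map_cat; exact: TensCatC.
- by move=> ? ? ?; rewrite scalerDr; exact: TensDl.
- by move=> ? ? ?; exact: TensDr.
- by move=> b x y; rewrite scalerA mulrC -scalerA; exact: TensZ.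
- by move=> ?; rewrite scaler0; exact: Tens0.
Qed.

Lemma tens_addE s t :
  tens_add (\pi_tensor s) (\pi_tensor t) = \pi_tensor (s ++ t).
Proof. by apply/tens_piP/TensCat; exact: tens_reprP. Qed.

Lemma tens_scaleE a s :
  tens_scale a (\pi_tensor s) = \pi_tensor [seq (a *: xy.1, xy.2) | xy <- s].
Proof. by apply/tens_piP/tens_rel_scale/tens_reprP. Qed.

Lemma tens_addA : associative tens_add.
Proof.
move=> p q r; elim/quotW: p => s; elim/quotW: q => t; elim/quotW: r => u.
by rewrite (tens_addE t u) (tens_addE s t) !tens_addE catA.
Qed.

Lemma tens_addC : commutative tens_add.
Proof.
move=> p q; elim/quotW: p => s; elim/quotW: q => t; rewrite !tens_addE.
by apply/tens_piP; exact: TensCatC.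
Qed.

Lemma tens_add0 : left_id tens_zero tens_add.
Proof. by move=> p; elim/quotW: p => s; rewrite tens_addE. Qed.

Lemma tens_scale1 : left_id 1 tens_scale.
Proof.
move=> p; elim/quotW: p => s; rewrite tens_scaleE; congr (\pi_tensor _).
by rewrite -[RHS]map_id; apply: eq_map => -[x y]; rewrite scale1r.
Qed.

Lemma tens_scaleDl p : {morph tens_scale^~ p : a b / a + b >-> tens_add a b}.
Proof.
elim/quotW: p => s a b; rewrite !tens_scaleE tens_addE; apply/tens_piP.
elim: s => [|[x y] s IHs] /=; first exact: TensRefl.
rewrite scalerDl -cat1s.
apply: (TensTrans (TensCat (TensDl _ _ _) IHs)) => /=.
set S1 := map _ s; set S2 := map _ s.
apply: (TensCat (TensRefl [:: (a *: x, y)])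
         (TensTrans (t := (S1 ++ [:: (b *: x, y)]) ++ S2) _ _)).
  exact: (TensCat (TensCatC [:: (b *: x, y)] S1) (TensRefl S2)).
by rewrite -catA; exact: TensRefl.
Qed.

Lemma tens_scaleDr : right_distributive tens_scale tens_add.
Proof.
move=> a p q; elim/quotW: p => s; elim/quotW: q => t.
by rewrite tens_addE !tens_scaleE tens_addE map_cat.
Qed.

Lemma tens_scaleA a b p : tens_scale a (tens_scale b p) = tens_scale (a * b) p.
Proof.
elim/quotW: p => s; rewrite (tens_scaleE b s) !tens_scaleE -map_comp.
congr (\pi_tensor _).
by apply: eq_map => -[x y] /=; rewrite scalerA.
Qed.

Lemma tens_scale0 p : tens_scale 0 p = tens_zero.
Proof.
elim/quotW: p => s; rewrite tens_scaleE; apply/tens_piP.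
elim: s => [|[x y] s IHs] /=; first exact: TensRefl.
by rewrite scale0r -cat1s; exact: (TensCat (Tens0 y) IHs).
Qed.

Lemma tens_addN : left_inverse tens_zero tens_opp tens_add.
Proof.
move=> p; rewrite -{2}[p]tens_scale1 /tens_opp -tens_scaleDl addNr.
exact: tens_scale0.
Qed.

HB.instance Definition _ :=
  GRing.isZmodule.Build tensor tens_addA tens_addC tens_add0 tens_addN.
HB.instance Definition _ :=
  GRing.Zmodule_isLmodule.Build K tensor
    tens_scaleA tens_scale1 tens_scaleDr tens_scaleDl.

Definition tens (x : U) (y : V) : tensor := \pi_tensor [:: (x, y)].

Lemma tens_sumE s : \pi_tensor s = \sum_(xy <- s) tens xy.1 xy.2.
Proof.
elim: s => [|[x y] s IHs]; first by rewrite big_nil.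
by rewrite big_cons -IHs -cat1s -tens_addE.
Qed.

Lemma tens_bilinear : is_bilinear tens.
Proof.
have zE a x y : a *: tens x y = \pi_tensor [:: (a *: x, y)].
  exact: (tens_scaleE a [:: (x, y)]).
have dE x y x' y' : tens x y + tens x' y' = \pi_tensor [:: (x, y); (x', y')].
  exact: (tens_addE [:: (x, y)] [:: (x', y')]).
split=> [y|x] a /= u v; rewrite zE dE; apply/tens_piP; first exact: TensDl.
apply: (TensTrans (TensDr _ _ _)).
apply: (TensCat (TensSym (TensZ _ _ _)) (TensRefl [:: (x, v)])).
Qed.

(* Sums of values of a bilinear map do not depend on the chosen formal sum. *)
Lemma tens_univ (W : lmodType K) (f : U -> V -> W) (s t : seq (U * V)) :
  is_bilinear f ->
  \sum_(xy <- s) tens xy.1 xy.2 = \sum_(xy <- t) tens xy.1 xy.2 ->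
  \sum_(xy <- s) f xy.1 xy.2 = \sum_(xy <- t) f xy.1 xy.2.
Proof.
move=> [fl fr]; rewrite -!tens_sumE => /tens_piP.
have fDl x x' y : f (x + x') y = f x y + f x' y.
  by have := fl y 1 x x'; rewrite /= !scale1r.
have fDr x y y' : f x (y + y') = f x y + f x y'.
  by have := fr x 1 y y'; rewrite /= !scale1r.
have f0l y : f 0 y = 0 by apply: (addrI (f 0 y)); rewrite -fDl !addr0.
have f0r x : f x 0 = 0 by apply: (addrI (f x 0)); rewrite -fDr !addr0.
elim=> {s t}.
- by [].
- by move=> s t _ ->.
- by move=> s t u _ -> _ ->.
- by move=> s s' t t' _ e _ e'; rewrite !big_cat /= e e'.
- by move=> s t; rewrite !big_cat /= addrC.
- by move=> x x' y; rewrite !big_cons !big_nil /= !addr0 fDl.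
- by move=> x y y'; rewrite !big_cons !big_nil /= !addr0 fDr.
- move=> a x y; rewrite !big_cons !big_nil /= !addr0.
  have := fl y a x 0; have := fr x a y 0.
  by rewrite /= !addr0 f0l f0r !addr0 => -> ->.
- by move=> y; rewrite big_cons !big_nil /= f0l addr0.
Qed.

End Tensor.

Notation "x '⊗' y" := (tens x y)
  (at level 40, left associativity) : ring_scope.

Section Dendriform.
Variables (K : fieldType) (A : lmodType K).
Implicit Types mul prec succ : A -> A -> A.

Definition is_associative_algebra mul := is_bilinear mul /\ associative mul.

Definition star prec succ (x y : A) : A := prec x y + succ x y.

Record is_dendriform prec succ : Prop := IsDendriform {
  prec_bilinear : is_bilinear prec;
  succ_bilinear : is_bilinear succ;
  prec_prec : forall x y z, prec (prec x y) z = prec x (star prec succ y z);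
  succ_prec : forall x y z, prec (succ x y) z = succ x (prec y z);
  succ_succ : forall x y z, succ x (succ y z) = succ (star prec succ x y) z
}.

Definition is_compatible_dendriform mul prec succ :=
  is_dendriform prec succ /\ forall x y, prec x y + succ x y = mul x y.

Section DEquation.
Variables prec succ : A -> A -> A.

(* s is a formal sum of the x_i (x) y_i *)
Definition r12_star_r13 (s : seq (A * A)) : tensor (tensor A A) A :=
  \sum_(p <- s) \sum_(q <- s) star prec succ p.1 q.1 ⊗ p.2 ⊗ q.2.

Definition r13_prec_r23 (s : seq (A * A)) : tensor (tensor A A) A :=
  \sum_(p <- s) \sum_(q <- s) p.1 ⊗ q.1 ⊗ prec p.2 q.2.

Definition r23_succ_r12 (s : seq (A * A)) : tensor (tensor A A) A :=
  \sum_(p <- s) \sum_(q <- s) q.1 ⊗ succ p.1 q.2 ⊗ p.2.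

Definition D_equation_on (s : seq (A * A)) : Prop :=
  r12_star_r13 s = r13_prec_r23 s + r23_succ_r12 s.

(* Any way of writing r as a sum of pure tensors gives the same equation, see
   D_equationP. *)
Definition D_equation (r : tensor A A) : Prop := D_equation_on (repr r).

End DEquation.

Lemma bilinear_comb (U V W : lmodType K) (f : U -> V -> W) : is_bilinear f ->
  (forall a x x' y, f (a *: x + x') y = a *: f x y + f x' y) *
  (forall a x y y', f x (a *: y + y') = a *: f x y + f x y').
Proof.
by move=> [fl fr]; split=> [a x x' y|a x y y']; [exact: fl | exact: fr].
Qed.

Lemma star_bilinear prec succ :
  is_bilinear prec -> is_bilinear succ -> is_bilinear (star prec succ).
Proof.
move=> /bilinear_comb [pl pr] /bilinear_comb [sl sr].
by split=> [y|x] a u v /=; rewrite /star ?pl ?pr ?sl ?sr addrACA scalerDr.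
Qed.

Lemma sum_quadrilinear (W : lmodType K) (F : A -> A -> A -> A -> W) s t :
  (forall x' y', is_bilinear (fun x y => F x y x' y')) ->
  (forall x y, is_bilinear (F x y)) ->
  \sum_(p <- s) p.1 ⊗ p.2 = \sum_(p <- t) p.1 ⊗ p.2 ->
  \sum_(p <- s) \sum_(q <- s) F p.1 p.2 q.1 q.2 =
  \sum_(p <- t) \sum_(q <- t) F p.1 p.2 q.1 q.2.
Proof.
move=> F12 F34 st.
transitivity (\sum_(p <- s) \sum_(q <- t) F p.1 p.2 q.1 q.2).
  by apply: eq_bigr => p _; exact: tens_univ.
rewrite exchange_big [RHS]exchange_big /=; apply: eq_bigr => q _.
exact: (tens_univ (F12 q.1 q.2)).
Qed.

Lemma D_equationP prec succ (s : seq (A * A)) (r : tensor A A) :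
  is_bilinear prec -> is_bilinear succ -> r = \sum_(p <- s) p.1 ⊗ p.2 ->
  D_equation prec succ r <-> D_equation_on prec succ s.
Proof.
move=> p_bil s_bil rs.
have [ml mr] := bilinear_comb (star_bilinear p_bil s_bil).
have [pl pr] := bilinear_comb p_bil; have [sl sr] := bilinear_comb s_bil.
have [tl tr] := bilinear_comb (tens_bilinear A A).
have [Tl Tr] := bilinear_comb (tens_bilinear (tensor A A) A).
have {}rs : \sum_(p <- repr r) p.1 ⊗ p.2 = \sum_(p <- s) p.1 ⊗ p.2.
  by rewrite -tens_sumE reprK.
rewrite /D_equation /D_equation_on.
rewrite /r12_star_r13 /r13_prec_r23 /r23_succ_r12.
rewrite (sum_quadrilinear
  (F := fun x y x' y' => star prec succ x x' ⊗ y ⊗ y') _ _ rs); first last.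
- by move=> ? ?; split=> [?|?] a u v /=; rewrite ?mr ?tl ?tr ?Tl ?Tr.
- by move=> ? ?; split=> [?|?] a u v /=; rewrite ?ml ?tl ?tr ?Tl ?Tr.
rewrite (sum_quadrilinear
  (F := fun x y x' y' => x ⊗ x' ⊗ prec y y') _ _ rs); first last.
- by move=> ? ?; split=> [?|?] a u v /=; rewrite ?pl ?pr ?tl ?tr ?Tl ?Tr.
- by move=> ? ?; split=> [?|?] a u v /=; rewrite ?pl ?pr ?tl ?tr ?Tl ?Tr.
rewrite (sum_quadrilinear
  (F := fun x y x' y' => x' ⊗ succ x y' ⊗ y) _ _ rs) //.
- by move=> ? ?; split=> [?|?] a u v /=; rewrite ?sl ?sr ?tl ?tr ?Tl ?Tr.
- by move=> ? ?; split=> [?|?] a u v /=; rewrite ?sl ?sr ?tl ?tr ?Tl ?Tr.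
Qed.

End Dendriform.

(* Main.v *)
Require Import Defs.
From mathcomp Require Import all_boot all_order all_algebra reals complex.
From mathcomp Require Import ring.

(** On a line spanned by [e], a bilinear product is determined by its structure
    constant, the scalar [c] such that [f e e = c *: e]. If [prec] and [succ]
    have constants [p] and [s], the dendriform axioms evaluated on a product of
    three multiples of [e] read [p * p = p * (p + s)], [s * p = s * p] and
    [s * s = (p + s) * s], so they all amount to [p * s = 0] (lemma
    [line_dendriformP]). Compatibility with a product of constant [m] adds
    [p + s = m]. For [m = 0] this forces [p = s = 0]; for [m = 1] it says that
    [s] is a root of [s * (1 - s)], hence is [0] or [1].

    The D-equation imposes nothing on a line: the three legs of the triple
    tensor product are all multiples of [e], so the position of the product is
    invisible and both sides have the coefficient [p + s], term by term (lemma
    [line_D_equation]). The solutions are thus all tensors, and these are the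
    multiples of [e ⊗ e] (lemma [line_tensor]). *)

Set Implicit Arguments.
Unset Strict Implicit.
Unset Printing Implicit Defensive.

Import GRing.Theory.

Local Open Scope ring_scope.

Lemma bilinear_scale (K : fieldType) (U V W : lmodType K) (f : U -> V -> W) :
  is_bilinear f -> forall a b x y, f (a *: x) (b *: y) = (a * b) *: f x y.
Proof.
move=> /bilinear_comb [fl fr] a b x y.
have f0l z : f 0 z = 0.
  by have := fl 1 0 0 z; rewrite !scale1r addr0 -{1}[f 0 z]addr0 => /addrI.
have f0r z : f z 0 = 0.
  by have := fr 1 z 0 0; rewrite !scale1r addr0 -{1}[f z 0]addr0 => /addrI.
rewrite -[a *: x]addr0 fl f0l addr0 -[b *: y]addr0 fr f0r addr0.
by rewrite scalerA.
Qed.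

Lemma tens_scale_scale (K : fieldType) (U V : lmodType K) a b (x : U) (y : V) :
  (a *: x) ⊗ (b *: y) = (a * b) *: (x ⊗ y).
Proof. exact: bilinear_scale (tens_bilinear U V) a b x y. Qed.

Lemma scale_bilinear (K : fieldType) (U V W : lmodType K) (f : U -> V -> W) c :
  is_bilinear f -> is_bilinear (fun x y => c *: f x y).
Proof.
move=> /bilinear_comb [fl fr]; split=> [y|x] a u v /=; rewrite ?fl ?fr.
  by rewrite scalerDr !scalerA mulrC.
by rewrite scalerDr !scalerA mulrC.
Qed.

Section Line.
Variables (K : fieldType) (A : lmodType K) (e : A).
Hypothesis e_neq0 : e != 0.
Hypothesis e_span : forall x, exists a, x = a *: e.
Implicit Types mul prec succ f g : A -> A -> A.

Lemma line_bilinear f c : is_bilinear f -> f e e = c *: e ->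
  forall a b, f (a *: e) (b *: e) = (a * b * c) *: e.
Proof. by move=> fb fe a b; rewrite bilinear_scale// fe scalerA. Qed.

Lemma line_bilinear_ext f g : is_bilinear f -> is_bilinear g ->
  f e e = g e e -> forall x y, f x y = g x y.
Proof.
move=> fb gb fg x y; have [a ->] := e_span x; have [b ->] := e_span y.
by rewrite !bilinear_scale// fg.
Qed.

Lemma line_scaleI : injective (fun a : K => a *: e).
Proof.
move=> a b /eqP; rewrite -subr_eq0 -scalerBl scaler_eq0 (negbTE e_neq0) orbF.
by rewrite subr_eq0 => /eqP.
Qed.

(** The two axioms that involve [star] each hold up to a multiple of the
    cross term [p * s], and the remaining one holds since both of its sides have
    the constant [s * p]. *)
Lemma line_dendriformP prec succ p s :
  is_bilinear prec -> is_bilinear succ ->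
  prec e e = p *: e -> succ e e = s *: e ->
  is_dendriform prec succ <-> p * s = 0.
Proof.
move=> pb sb pe se.
have pE := line_bilinear pb pe; have sE := line_bilinear sb se.
have mE a b : star prec succ (a *: e) (b *: e) = (a * b * (p + s)) *: e.
  by rewrite /star pE sE -scalerDl mulrDr.
split=> [[_ _ pp _ _]|ps0].
  (* Writing [e] as [1 *: e] lets the formulas on multiples of [e] apply. *)
  have := pp (1 *: e) (1 *: e) (1 *: e).
  rewrite mE !pE => /line_scaleI; rewrite !mul1r mulr1 mulrDl.
  by rewrite -{1}[p * p]addr0 => /addrI; rewrite mulrC.
(* [ring] ignores the hypothesis [p * s = 0], so the vanishing cross term is
   added to the side that lacks it. *)
split=> // x y z; have [a ->] := e_span x; have [b ->] := e_span y;
  have [c ->] := e_span z; rewrite ?mE !(pE, sE) ?mE; congr (_ *: e).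
- rewrite -[LHS]addr0 -[X in _ + X](mulr0 (a * b * c)) -ps0; ring.
- ring.
- rewrite -[LHS]addr0 -[X in _ + X](mulr0 (a * b * c)) -ps0; ring.
Qed.

(** Compatibility determines [prec] from [succ] and [mul], so one scalar [s]
    parametrizes all candidates and the dendriform axioms become a quadratic
    equation in [s]. *)
Lemma line_compatibleP mul prec succ m : is_bilinear mul -> mul e e = m *: e ->
  is_compatible_dendriform mul prec succ <->
  [/\ is_bilinear prec, is_bilinear succ
    & exists s, [/\ (m - s) * s = 0, succ e e = s *: e
                  & prec e e = (m - s) *: e]].
Proof.
move=> mb me; split=> [[den comp]|[pb sb [s [ms0 se pe]]]].
  have pb := prec_bilinear den; have sb := succ_bilinear den.
  have [s se] := e_span (succ e e).
  have pe : prec e e = (m - s) *: e.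
    by rewrite scalerBl -me -comp se addrK.
  by split=> //; exists s; split=> //; apply/(line_dendriformP pb sb pe se).
split; first exact/(line_dendriformP pb sb pe se).
apply: line_bilinear_ext (star_bilinear pb sb) mb _.
by rewrite /star pe se me -scalerDl subrK.
Qed.

(** Every compatible structure on a line is a splitting of the product by two
    complementary scalars, which gives the witnesses for existence. *)
Lemma line_split_compatible mul m lam : is_bilinear mul -> mul e e = m *: e ->
  (1 - lam) * lam * m = 0 ->
  is_compatible_dendriform mul (fun x y => (1 - lam) *: mul x y)
                               (fun x y => lam *: mul x y).
Proof.
move=> mb me lm0; apply/(line_compatibleP _ _ mb me).
split; try exact: scale_bilinear.
exists (lam * m); rewrite me !scalerA; split=> //.
  by transitivity ((1 - lam) * lam * m * m); [ring | rewrite lm0 mul0r].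
by congr (_ *: e); ring.
Qed.

Lemma line_tensor (r : tensor A A) : exists a, r = a *: (e ⊗ e).
Proof.
rewrite -[r]generic_quotient.reprK tens_sumE.
elim: (generic_quotient.repr r) => [|[x y] t [c IH]].
  by exists 0; rewrite big_nil scale0r.
have [a ->] := e_span x; have [b ->] := e_span y.
by exists (a * b + c); rewrite big_cons IH tens_scale_scale scalerDl.
Qed.

(** For any expression of [r] as a formal sum, the summands of the two sides
    agree pair by pair: every leg is a multiple of [e], and moving the scalars
    out leaves the product of the four coordinates times [p + s]. *)
Lemma line_D_equation prec succ (r : tensor A A) :
  is_bilinear prec -> is_bilinear succ -> D_equation prec succ r.
Proof.
move=> pb sb; have [p pe] := e_span (prec e e).
have [s se] := e_span (succ e e).
have pE := line_bilinear pb pe; have sE := line_bilinear sb se.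
rewrite /D_equation /D_equation_on /r12_star_r13 /r13_prec_r23 /r23_succ_r12.
rewrite -big_split; apply: eq_bigr => -[x y] _.
rewrite -big_split; apply: eq_bigr => -[x' y'] _ /=.
have [a ->] := e_span x; have [b ->] := e_span y.
have [a' ->] := e_span x'; have [b' ->] := e_span y'.
rewrite /star pE sE -scalerDl pE sE !tens_scale_scale -scalerDl.
by congr (_ *: _); ring.
Qed.

Lemma line_D_solutions prec succ :
  is_bilinear prec -> is_bilinear succ -> forall r : tensor A A,
  D_equation prec succ r <-> exists a, r = a *: (e ⊗ e).
Proof.
by move=> pb sb r; split=> _; [exact: line_tensor | exact: line_D_equation].
Qed.

End Line.

Theorem proposition3p2 (R : realType) (A : vectType R[i]) (e1 : A)
    (he1 : basis_of fullv [:: e1])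
    (mul : A -> A -> A) (hmul : is_associative_algebra mul) :
  (mul e1 e1 = 0 ->
     [/\ exists prec succ : A -> A -> A, is_compatible_dendriform mul prec succ,
         forall prec succ : A -> A -> A,
           is_compatible_dendriform mul prec succ <->
           [/\ is_bilinear prec, is_bilinear succ,
               prec e1 e1 = 0 & succ e1 e1 = 0]
       & forall prec succ : A -> A -> A,
           is_compatible_dendriform mul prec succ ->
           forall r : tensor A A,
             D_equation prec succ r <->
             exists a11 : R[i], r = a11 *: (e1 ⊗ e1)])
  /\
  (mul e1 e1 = e1 ->
     [/\ forall lam : R[i], lam = 0 \/ lam = 1 ->
           exists prec succ : A -> A -> A,
             [/\ is_compatible_dendriform mul prec succ,
                 succ e1 e1 = lam *: e1 & prec e1 e1 = (1 - lam) *: e1],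
         forall prec succ : A -> A -> A,
           is_compatible_dendriform mul prec succ <->
           [/\ is_bilinear prec, is_bilinear succ
             & exists lam : R[i],
               [/\ lam = 0 \/ lam = 1, succ e1 e1 = lam *: e1
                 & prec e1 e1 = (1 - lam) *: e1]]
       & forall prec succ : A -> A -> A,
           is_compatible_dendriform mul prec succ ->
           forall r : tensor A A,
             D_equation prec succ r <->
             exists a11 : R[i], r = a11 *: (e1 ⊗ e1)]).
Proof.
have e_neq0 : e1 != 0 by have := basis_free he1; rewrite free_cons => /andP[];
  rewrite span_nil memv0.
have e_span x : exists a, x = a *: e1.
  by apply/vlineP; rewrite -span_seq1 (span_basis he1) memvf.
have [mb _] := hmul.
have sol prec succ : is_compatible_dendriform mul prec succ ->
    forall r : tensor A A,
    D_equation prec succ r <-> exists a, r = a *: (e1 ⊗ e1).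
  by case=> -[pb sb _ _ _] _; exact: line_D_solutions.
split=> me.
- have {}me : mul e1 e1 = 0 *: e1 by rewrite scale0r.
  split=> [|prec succ|//].
    by do 2!eexists; apply: (line_split_compatible e_neq0 e_span (lam := 0) mb me);
      rewrite mulr0.
  rewrite (line_compatibleP e_neq0 e_span prec succ mb me).
  split=> [[pb sb [s []]]|[pb sb pe se]].
    rewrite sub0r mulNr => /eqP; rewrite oppr_eq0 mulf_eq0 orbb => /eqP ->.
    by rewrite oppr0 scale0r => se pe; split.
  by split=> //; exists 0; rewrite subr0 mulr0 scale0r.
- have me1 : mul e1 e1 = 1 *: e1 by rewrite scale1r.
  have lamP (lam : R[i]) : lam = 0 \/ lam = 1 <-> (1 - lam) * lam = 0.
    split=> [[]->|/eqP]; first by rewrite mulr0.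
      by rewrite subrr mul0r.
    by rewrite mulf_eq0 subr_eq0 => /orP[/eqP <-|/eqP ->]; [right|left].
  split=> [lam /lamP lam01|prec succ|//].
    exists (fun x y => (1 - lam) *: mul x y), (fun x y => lam *: mul x y).
    rewrite me; split=> //.
    by apply: (line_split_compatible e_neq0 e_span mb me1); rewrite mulr1.
  rewrite (line_compatibleP e_neq0 e_span prec succ mb me1).
  by split=> -[pb sb [s [/lamP ? ? ?]]]; split=> //; exists s.
Qed.
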